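(* Let $n \ge 1$ and let $K_n$ be the complete graph on $n$ vertices. Then $\mathrm{Pin}(K_n) = \{\{n\}\}$ (i.e., $\{n\}$ is the only pinnacle set of $K_n$) and $\mathrm{pin}(K_n) = 1$.
   Context: Graphs are finite and simple, and $[n] = \{1,2,\ldots,n\}$. A labeling of a graph $G$ with $n$ vertices is a bijection $\lambda : V(G) \to [n]$. The label $\lambda(u)$ of a vertex $u$ is a pinnacle of $(G,\lambda)$ if $\lambda(u) > \lambda(v)$ for every neighbor $v$ of $u$ (so the label of an isolated vertex is vacuously a pinnacle). The pinnacle set of $(G,\lambda)$ is the set of all pinnacles of $(G,\lambda)$. A subset $S \subseteq [n]$ is a pinnacle set of $G$ if there is a labeling $\lambda$ of $G$ such that $S$ is the pinnacle set of $(G,\lambda)$. $\mathrm{Pin}(G)$ denotes the collection of all pinnacle sets of $G$, and $\mathrm{pin}(G) = |\mathrm{Pin}(G)|$. *)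

(* Defs.v *)
From mathcomp Require Import all_boot.
From mathcomp Require Import finmap.

Set Implicit Arguments.
Unset Strict Implicit.
Unset Printing Implicit Defensive.

Local Open Scope fset_scope.

Record sgraph := SGraph {
  vertex :> finType;
  adj : rel vertex;
  adj_sym : symmetric adj;
  adj_irrefl : irreflexive adj
}.

Fact complete_sym n : symmetric (fun u v : 'I_n => u != v).
Proof. by move=> u v; rewrite eq_sym. Qed.

Fact complete_irrefl n : irreflexive (fun u v : 'I_n => u != v).
Proof. by move=> u; rewrite eqxx. Qed.

Definition complete_graph (n : nat) : sgraph :=
  SGraph (@complete_sym n) (@complete_irrefl n).

(* [n] = {1, ..., n}; as a finite set of naturals it coerces to a finType. *)
Definition interval1 (n : nat) : {fset nat} := [fset i in iota 1 n].

Section Pinnacles.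
Variable G : sgraph.
Implicit Types (l : {ffun G -> interval1 #|G|}) (S : {fset nat}).

(* Boolean form of "l is a bijection from V(G) to [n]"; see [labelingP]. *)
Definition labeling l : bool :=
  injectiveb l && [forall i, exists u, l u == i].

Definition has_pinnacle l (u : G) : bool :=
  [forall v, adj u v ==> (fsval (l v) < fsval (l u))].

Definition pinnacle_set l : {fset nat} :=
  [fset fsval (l u) | u : G & has_pinnacle l u].

Definition is_pinnacle_set S : bool :=
  (S `<=` interval1 #|G|) && [exists l, labeling l && (S == pinnacle_set l)].

Definition Pin : {fset {fset nat}} :=
  [fset S in fpowerset (interval1 #|G|) | is_pinnacle_set S].

Definition pin : nat := #|` Pin|.

Lemma labelingP l : reflect (bijective l) (labeling l).
Proof.
apply: (iffP andP) => [[/injectiveP l_inj /forallP l_surj]|[g lK gK]].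
  have ex i : exists u, l u == i by apply/existsP.
  exists (fun i => xchoose (ex i)) => [u|i]; last exact/eqP/(xchooseP (ex i)).
  by apply: l_inj; apply/eqP/(xchooseP (ex (l u))).
split; first exact/injectiveP/(can_inj lK).
by apply/forallP => i; apply/existsP; exists (g i); rewrite gK.
Qed.

Lemma in_pinnacle_set l (k : nat) :
  reflect (exists2 u, k = fsval (l u)
             & forall v, adj u v -> fsval (l v) < fsval (l u))
          (k \in pinnacle_set l).
Proof.
apply: (iffP (imfsetP _ _ _ _)) => /= [[u]|[u -> hu]].
  rewrite inE => /forallP hu ->; exists u => // v uv.
  by have /implyP := hu v; apply.
exists u => //; rewrite inE.
by apply/forallP => v; apply/implyP; apply: hu.
Qed.

Lemma in_interval1 n k : (k \in interval1 n) = (1 <= k <= n).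
Proof. by rewrite !inE mem_iota add1n ltnS. Qed.

Lemma in_Pin S :
  reflect (S `<=` interval1 #|G| /\
           exists2 l : {ffun G -> interval1 #|G|},
             bijective l & S = pinnacle_set l)
          (S \in Pin).
Proof.
rewrite !inE /= fpowersetE.
apply: (iffP and3P) => [[_ sS /existsP[l /andP[/labelingP lb /eqP ->]]]|].
  by split; [apply/fsubsetP => k /in_pinnacle_set[u -> _]; apply: fsvalP
           | exists l].
move=> [sS [l /labelingP lb eqS]]; split=> //.
by apply/existsP; exists l; rewrite lb eqS eqxx.
Qed.

End Pinnacles.

(* Main.v *)
Require Import Defs.
From mathcomp Require Import all_boot.
From mathcomp Require Import finmap.

(** In a complete graph any two distinct vertices are adjacent, so the label of
    a vertex is a pinnacle exactly when it exceeds all the other labels.  A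
    labeling is onto [1..n], hence the only such label is n
    ([pinnacle_set_complete]).  Every labeling thus gives the same pinnacle set,
    and this set is attained because labelings exist ([exists_labeling]). *)

Local Open Scope fset_scope.

Lemma card_interval1 n : #|` interval1 n| = n.
Proof. by rewrite card_fseq undup_id ?iota_uniq // size_iota. Qed.

(** Both sides have the same cardinality, so composing their canonical
    enumerations gives a bijection. *)
Lemma exists_labeling (G : sgraph) :
  exists l : {ffun G -> interval1 #|G|}, bijective l.
Proof.
have eqc : #|G| = #|{: interval1 #|G|}| by rewrite -cardfE card_interval1.
have cast_bij : bijective (cast_ord eqc).
  by exists (cast_ord (esym eqc)); [apply: cast_ordK | apply: cast_ordKV].
exists [ffun u : G => enum_val (cast_ord eqc (enum_rank u))].
apply: (eq_bij (bij_comp (bij_comp (@enum_val_bij _) cast_bij)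
                  (@enum_rank_bij _))).
by move=> u; rewrite ffunE.
Qed.

Lemma pinnacle_set_complete (n : nat)
    (l : {ffun complete_graph n -> interval1 #|complete_graph n|}) :
  0 < n -> bijective l -> pinnacle_set l = [fset n].
Proof.
move=> n_gt0 [g lK gK].
have cardG : #|complete_graph n| = n by exact: card_ord.
have l_le u : fsval (l u) <= n.
  by rewrite -[X in _ <= X]cardG; have := fsvalP (l u); rewrite in_interval1 => /andP[].
have n_in : n \in interval1 #|complete_graph n|.
  by rewrite in_interval1 cardG n_gt0 leqnn.
have l_top : fsval (l (g [` n_in])) = n by rewrite gK.
apply/fsetP => k; rewrite in_fset1; apply/in_pinnacle_set/eqP => [[u -> u_max]|->].
  have [->//|u_top] := eqVneq u (g [` n_in]).
  (* The vertex labelled n would be a neighbour of u with a smaller label. *)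
  by have := u_max _ u_top; rewrite l_top ltnNge l_le.
exists (g [` n_in]) => // v top_v; rewrite ltn_neqAle l_top l_le andbT.
apply: contraNneq top_v => lv; apply/eqP/(can_inj lK)/val_inj.
by rewrite [LHS]l_top [RHS]lv.
Qed.

Theorem lemma3p1 (n : nat) (hn : 1 <= n) :
  Pin (complete_graph n) = [fset [fset n]] /\ pin (complete_graph n) = 1.
Proof.
suff PinE : Pin (complete_graph n) = [fset [fset n]].
  by split; rewrite // /pin PinE cardfs1.
apply/fsetP => S; rewrite in_fset1; apply/in_Pin/eqP => [[_ [l l_bij ->]]|->].
  exact: pinnacle_set_complete.
have [l l_bij] := exists_labeling (complete_graph n).
split; last by exists l; rewrite // pinnacle_set_complete.
by rewrite fsub1set in_interval1 [#|_|]card_ord hn leqnn.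
Qed.
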